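(* Let $H_1,H_2\in\mathbb{H}^{n\times n}$ be invertible Hermitian quaternion matrices defining inner products $[x,y]_1=y^*H_1x$ and $[x,y]_2=y^*H_2x$ on $\mathbb{H}^n$, and assume $\pi(H_1)=\pi(H_2)$. Let $V_1,V_2$ be subspaces of $\mathbb{H}^n$ and let $U_0:V_1\to V_2$ be a nonsingular linear transformation such that $[U_0x,U_0y]_2=[x,y]_1$ for all $x,y\in V_1$. Then there exists a linear transformation $U:\mathbb{H}^n\to\mathbb{H}^n$ such that $[Ux,Uy]_2=[x,y]_1$ for all $x,y\in\mathbb{H}^n$ and $Ux=U_0x$ for all $x\in V_1$.
   Context: $\mathbb{H}$ denotes the real quaternions; $\mathbb{H}^n$ is a right vector space over $\mathbb{H}$, and $A^*$ denotes the conjugate transpose of a quaternion matrix. Eigenvalues of a quaternion Hermitian matrix are real; $\pi(H)$ denotes the number of positive eigenvalues (counted with multiplicity) of the Hermitian matrix $H$. *)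

(* Defs.v *)
From HB Require Import structures.
From mathcomp Require Import all_boot all_order all_algebra.
From mathcomp Require Import ring.
From mathcomp Require Import reals.
Set Implicit Arguments. Unset Strict Implicit. Unset Printing Implicit Defensive.
Import Order.TTheory GRing.Theory Num.Theory.
Local Open Scope ring_scope.

Section Quaternions.
Variable R : realType.

(* q = q0 + q1 i + q2 j + q3 k *)
Record quat := Quat { q0 : R; q1 : R; q2 : R; q3 : R }.

Definition quat_to (q : quat) := (q0 q, q1 q, q2 q, q3 q).
Definition quat_of (t : R * R * R * R) :=
  let: (a, b, c, d) := t in Quat a b c d.
Lemma quat_toK : cancel quat_to quat_of. Proof. by case. Qed.
HB.instance Definition _ := Equality.copy quat (can_type quat_toK).
HB.instance Definition _ := Choice.copy quat (can_type quat_toK).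

Definition qzero := Quat 0 0 0 0.
Definition qadd (p q : quat) :=
  Quat (q0 p + q0 q) (q1 p + q1 q) (q2 p + q2 q) (q3 p + q3 q).
Definition qopp (p : quat) := Quat (- q0 p) (- q1 p) (- q2 p) (- q3 p).

Lemma qaddA : associative qadd.
Proof. by case=> ? ? ? ?; case=> ? ? ? ?; case=> ? ? ? ?; rewrite /qadd /=; congr Quat; ring. Qed.
Lemma qaddC : commutative qadd.
Proof. by case=> ? ? ? ?; case=> ? ? ? ?; rewrite /qadd /=; congr Quat; ring. Qed.
Lemma qadd0 : left_id qzero qadd.
Proof. by case=> ? ? ? ?; rewrite /qadd /=; congr Quat; ring. Qed.
Lemma qaddN : left_inverse qzero qopp qadd.
Proof. by case=> ? ? ? ?; rewrite /qadd /=; congr Quat; ring. Qed.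

HB.instance Definition _ := GRing.isZmodule.Build quat qaddA qaddC qadd0 qaddN.

Definition qone := Quat 1 0 0 0.
(* Hamilton product: i^2 = j^2 = k^2 = ijk = -1 *)
Definition qmul (p q : quat) :=
  Quat (q0 p * q0 q - q1 p * q1 q - q2 p * q2 q - q3 p * q3 q)
       (q0 p * q1 q + q1 p * q0 q + q2 p * q3 q - q3 p * q2 q)
       (q0 p * q2 q - q1 p * q3 q + q2 p * q0 q + q3 p * q1 q)
       (q0 p * q3 q + q1 p * q2 q - q2 p * q1 q + q3 p * q0 q).

Lemma qmulA : associative qmul.
Proof. by case=> ? ? ? ?; case=> ? ? ? ?; case=> ? ? ? ?; rewrite /qmul /=; congr Quat; ring. Qed.
Lemma qmul1 : left_id qone qmul.
Proof. by case=> ? ? ? ?; rewrite /qmul /=; congr Quat; ring. Qed.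
Lemma qmulr1 : right_id qone qmul.
Proof. by case=> ? ? ? ?; rewrite /qmul /=; congr Quat; ring. Qed.
Lemma qmulDl' : left_distributive qmul qadd.
Proof. by case=> ? ? ? ?; case=> ? ? ? ?; case=> ? ? ? ?; rewrite /qmul /= /qadd /=; congr Quat; ring. Qed.
Lemma qmulDr' : right_distributive qmul qadd.
Proof. by case=> ? ? ? ?; case=> ? ? ? ?; case=> ? ? ? ?; rewrite /qmul /= /qadd /=; congr Quat; ring. Qed.
Lemma qmulDl : left_distributive qmul +%R. Proof. exact: qmulDl'. Qed.
Lemma qmulDr : right_distributive qmul +%R. Proof. exact: qmulDr'. Qed.
Lemma qone_neq0 : qone != 0.
Proof. by apply/eqP => -[]; apply/eqP; rewrite oner_neq0. Qed.

HB.instance Definition _ := GRing.Zmodule_isNzRing.Build quat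
  qmulA qmul1 qmulr1 qmulDl qmulDr qone_neq0.

Definition qconj (q : quat) := Quat (q0 q) (- q1 q) (- q2 q) (- q3 q).
Definition realq (r : R) := Quat r 0 0 0.

End Quaternions.

Arguments realq {R}.

Section QMatrices.
Variable R : realType.
Local Notation H := (quat R).

Definition qadj m n (A : 'M[H]_(m, n)) : 'M[H]_(n, m) := map_mx (@qconj R) A^T.

Definition qhermitian n (A : 'M[H]_n) : Prop := qadj A = A.
Definition qinvertible n (A : 'M[H]_n) : Prop :=
  exists B : 'M[H]_n, B *m A = 1%:M /\ A *m B = 1%:M.

Definition ip n (A : 'M[H]_n) (x y : 'cV[H]_n) : 'M[H]_1 := qadj y *m A *m x.

Definition rscale n (x : 'cV[H]_n) (c : H) : 'cV[H]_n := map_mx (fun a => a * c) x.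

Definition subspace n (V : 'cV[H]_n -> Prop) : Prop :=
  [/\ V 0, (forall x y, V x -> V y -> V (x + y)) &
      (forall x c, V x -> V (rscale x c))].

Definition rindep n k (v : 'I_k -> 'cV[H]_n) : Prop :=
  forall c : 'I_k -> H, \sum_(i < k) rscale (v i) (c i) = 0 -> forall i, c i = 0.

Definition dim_is n (S : 'cV[H]_n -> Prop) (d : nat) : Prop :=
  (exists v : 'I_d -> 'cV[H]_n, (forall i, S (v i)) /\ rindep v) /\
  (forall v : 'I_d.+1 -> 'cV[H]_n, (forall i, S (v i)) -> ~ rindep v).

Definition eigenspace n (A : 'M[H]_n) (l : R) : 'cV[H]_n -> Prop :=
  fun x => A *m x = rscale x (realq l).

Definition real_eigenvalue n (A : 'M[H]_n) (l : R) : Prop :=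
  exists x : 'cV[H]_n, x != 0 /\ eigenspace A l x.

(* pos_inertia A k : pi(A) = k, the number of positive eigenvalues of the
   Hermitian matrix A counted with multiplicity: s lists the distinct positive
   eigenvalues, d their multiplicities (dimension of the eigenspace). *)
Definition pos_inertia n (A : 'M[H]_n) (k : nat) : Prop :=
  exists (s : seq R) (d : seq nat),
    [/\ uniq s, size d = size s,
        (forall l, l \in s <-> (0 < l /\ real_eigenvalue A l)),
        (forall i, (i < size s)%N -> dim_is (eigenspace A (nth 0 s i)) (nth 0%N d i))
      & k = sumn d].

End QMatrices.

(* Main.v *)
Require Import Defs.
From HB Require Import structures.
From mathcomp Require Import all_boot all_order all_algebra.
From mathcomp Require Import ring lra.
From mathcomp Require Import boolp reals complex.
Import Order.TTheory GRing.Theory Num.Theory.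
Set Implicit Arguments. Unset Strict Implicit. Unset Printing Implicit Defensive.
Local Open Scope ring_scope.

(* Choose a basis [A] of [V1] and put [B := U0 A]; then [A] and [B] have the
   same Gram matrix [G], and the two families can be enlarged one vector at a
   time, keeping the Gram matrices equal.  If [G] is singular, any vector not
   orthogonal to a radical vector [r] of the span of [A] works: on the other
   side the products with [B] are prescribed by nondegeneracy, and the square
   is corrected by adding a multiple of the isotropic vector [U0 r].  If [G] is
   invertible, the orthogonal complement of [A], unless zero, contains a vector
   of nonzero square, and the complement of [B] contains one of the same sign,
   since both forms have the same maximal dimension of a positive (resp.
   negative) definite subspace.  Once the complement of [A] is zero,
   [U := B G^-1 A^* H1] is the required isometry.  The link with eigenvalues is
   that a Hermitian matrix is nonpositive on the orthogonal complement of its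
   eigenvectors with positive eigenvalue. *)

Local Notation "A ^!" := (qadj A).

Section QuaternionAlgebra.
Variable R : realType.
Local Notation H := (quat R).

Lemma quatP (p q : H) :
  [/\ q0 p = q0 q, q1 p = q1 q, q2 p = q2 q & q3 p = q3 q] -> p = q.
Proof. by case: p => a b c d; case: q => a' b' c' d' /= [-> -> -> ->]. Qed.

Fact q0_is_additive : zmod_morphism (@q0 R).
Proof. by case=> a b c d; case. Qed.
HB.instance Definition _ := GRing.isZmodMorphism.Build H R (@q0 R) q0_is_additive.
Fact q1_is_additive : zmod_morphism (@q1 R).
Proof. by case=> a b c d; case. Qed.
HB.instance Definition _ := GRing.isZmodMorphism.Build H R (@q1 R) q1_is_additive.
Fact q2_is_additive : zmod_morphism (@q2 R).
Proof. by case=> a b c d; case. Qed.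
HB.instance Definition _ := GRing.isZmodMorphism.Build H R (@q2 R) q2_is_additive.
Fact q3_is_additive : zmod_morphism (@q3 R).
Proof. by case=> a b c d; case. Qed.
HB.instance Definition _ := GRing.isZmodMorphism.Build H R (@q3 R) q3_is_additive.

Fact realq_is_additive : zmod_morphism (@realq R).
Proof. by move=> a b; apply: quatP; split; rewrite /= ?subr0. Qed.
HB.instance Definition _ := GRing.isZmodMorphism.Build R H (@realq R) realq_is_additive.
Fact realq_is_monoid_morphism : monoid_morphism (@realq R).
Proof. by split=> // a b; apply: quatP; split; rewrite /=; ring. Qed.
HB.instance Definition _ :=
  GRing.isMonoidMorphism.Build R H (@realq R) realq_is_monoid_morphism.

Fact qconj_is_additive : zmod_morphism (@qconj R).
Proof. by case=> a b c d; case=> *; apply: quatP; split=> //=; rewrite opprB opprK addrC. Qed.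
HB.instance Definition _ := GRing.isZmodMorphism.Build H H (@qconj R) qconj_is_additive.

Lemma qconjM (p q : H) : qconj (p * q) = qconj q * qconj p.
Proof. by case: p => *; case: q => *; apply: quatP; split; rewrite /=; ring. Qed.

Lemma qconjK (p : H) : qconj (qconj p) = p.
Proof. by apply: quatP; split; rewrite //= opprK. Qed.

Lemma qconj_realq (a : R) : qconj (realq a) = realq a.
Proof. by apply: quatP; split; rewrite //= oppr0. Qed.

Lemma qconj_fixed (p : H) : qconj p = p -> p = realq (q0 p).
Proof. by case: p => a b c d [*]; apply: quatP; split=> //=; lra. Qed.

Lemma q0_qconj (p : H) : q0 (qconj p) = q0 p. Proof. by []. Qed.

Lemma q0_realqM (a : R) (p : H) : q0 (realq a * p) = a * q0 p.
Proof. by rewrite /=; ring. Qed.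

Lemma realq_comm (a : R) (p : H) : realq a * p = p * realq a.
Proof. by case: p => *; apply: quatP; split; rewrite /=; ring. Qed.

Definition qnorm (p : H) : R := q0 p ^+ 2 + q1 p ^+ 2 + q2 p ^+ 2 + q3 p ^+ 2.

Lemma qconj_mulL (p : H) : qconj p * p = realq (qnorm p).
Proof. by case: p => *; apply: quatP; split; rewrite /qnorm /=; ring. Qed.

Lemma qconj_mulR (p : H) : p * qconj p = realq (qnorm p).
Proof. by case: p => *; apply: quatP; split; rewrite /qnorm /=; ring. Qed.

Lemma qnorm_ge0 (p : H) : 0 <= qnorm p.
Proof. by rewrite /qnorm; do !apply: addr_ge0; exact: sqr_ge0. Qed.

Lemma qnorm0 : qnorm 0 = 0. Proof. by rewrite /qnorm /=; ring. Qed.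

Lemma qnorm_eq0 (p : H) : (qnorm p == 0) = (p == 0).
Proof.
apply/eqP/eqP => [|->]; last exact: qnorm0.
by case: p => a b c d; rewrite /qnorm /= => e; apply: quatP; split => /=; nra.
Qed.

Lemma qnorm_gt0 (p : H) : p != 0 -> 0 < qnorm p.
Proof. by rewrite -qnorm_eq0 lt_neqAle qnorm_ge0 andbT eq_sym. Qed.

Definition qinv (p : H) : H := realq (qnorm p)^-1 * qconj p.

Lemma qmulV (p : H) : p != 0 -> p * qinv p = 1.
Proof.
rewrite -qnorm_eq0 => p0; rewrite /qinv mulrA -realq_comm -mulrA qconj_mulR.
by rewrite -rmorphM mulVf ?rmorph1.
Qed.

Lemma qmulVl (p : H) : p != 0 -> qinv p * p = 1.
Proof.
by rewrite -qnorm_eq0 => p0; rewrite /qinv -mulrA qconj_mulL -rmorphM mulVf ?rmorph1.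
Qed.

Lemma qmul_eq0 (p q : H) : p * q = 0 -> p != 0 -> q = 0.
Proof. by move=> pq0 /qmulVl p1; rewrite -[q]mul1r -p1 -mulrA pq0 mulr0. Qed.

Lemma qadjE m n (A : 'M[H]_(m, n)) i j : A^! i j = qconj (A j i).
Proof. by rewrite !mxE. Qed.

Lemma qadjM m n p (A : 'M[H]_(m, n)) (B : 'M[H]_(n, p)) : (A *m B)^! = B^! *m A^!.
Proof.
apply/matrixP => i j; rewrite qadjE !mxE raddf_sum; apply: eq_bigr => k _.
by rewrite !qadjE -qconjM.
Qed.

Lemma qadjK m n (A : 'M[H]_(m, n)) : A^!^! = A.
Proof. by apply/matrixP => i j; rewrite !qadjE qconjK. Qed.

Fact qadj_is_additive m n : zmod_morphism (@qadj R m n).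
Proof. by move=> A B; apply/matrixP => i j; rewrite !mxE raddfB. Qed.
HB.instance Definition _ m n :=
  GRing.isZmodMorphism.Build 'M[H]_(m, n) 'M[H]_(n, m) (@qadj R m n)
    (@qadj_is_additive m n).

Lemma qadj_row_mx m n1 n2 (A : 'M[H]_(m, n1)) (B : 'M[H]_(m, n2)) :
  (row_mx A B)^! = col_mx A^! B^!.
Proof. by rewrite /qadj tr_row_mx map_col_mx. Qed.

Lemma qadj1 n : (1%:M : 'M[H]_n)^! = 1%:M.
Proof.
apply/matrixP => i j; rewrite !mxE raddfMn eq_sym; congr (_ *+ _).
by apply: quatP; split; rewrite /= ?oppr0.
Qed.

Lemma realqZ_mulmx m n p (a : R) (A : 'M[H]_(m, n)) (B : 'M[H]_(n, p)) :
  A *m (realq a *: B) = realq a *: (A *m B).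
Proof.
apply/matrixP => i j; rewrite !mxE big_distrr; apply: eq_bigr => k _ /=.
by rewrite mxE !mulrA realq_comm.
Qed.

Lemma qadj_realqZ m n (a : R) (A : 'M[H]_(m, n)) : (realq a *: A)^! = realq a *: A^!.
Proof. by apply/matrixP => i j; rewrite !mxE qconjM qconj_realq realq_comm. Qed.

Lemma rscaleE n (x : 'cV[H]_n) c : rscale x c = x *m (c%:M : 'M_1).
Proof. by apply/matrixP => i j; rewrite !mxE big_ord1 !mxE !ord1 eqxx mulr1n. Qed.

Lemma rscale_realq n (x : 'cV[H]_n) a : rscale x (realq a) = realq a *: x.
Proof. by apply/matrixP => i j; rewrite !mxE realq_comm. Qed.

Definition injmx m n (A : 'M[H]_(m, n)) := forall c : 'cV_n, A *m c = 0 -> c = 0.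

Lemma underdetermined m n (A : 'M[H]_(m, n)) :
  (m < n)%N -> exists2 c : 'cV_n, c != 0 & A *m c = 0.
Proof.
elim: m n A => [|m IH] [|n] A // ltmn.
  exists (const_mx 1); last by apply/matrixP => -[].
  by apply/eqP => /matrixP/(_ 0 0)/eqP; rewrite !mxE oner_eq0.
have [[j aj0]|A0] := pselect (exists j, A 0 j != 0); last first.
  have [|c c0 Ac] := IH n.+1 (row' 0 A); first exact: leqW ltmn.
  exists c => //; apply/matrixP => i k; rewrite !mxE.
  case: (unliftP 0 i) => [i' ->|->].
    have /matrixP/(_ i' k) := Ac; rewrite !mxE => e; rewrite -[RHS]e.
    by apply: eq_bigr => l _; rewrite [in RHS]mxE.
  apply: big1 => l _; suff -> : A 0 l = 0 by rewrite mul0r.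
  by apply/eqP/negPn/negP => Al; apply: A0; exists l.
pose A' := \matrix_(i, l) (A (lift 0 i) (lift j l)
  - A (lift 0 i) j * qinv (A 0 j) * A 0 (lift j l)).
have [c c0 A'c] := IH n A' ltmn.
pose s := \sum_l A 0 (lift j l) * c l 0.
pose c' : 'cV[H]_n.+1 :=
  \col_l if unlift j l is Some l' then c l' 0 else - (qinv (A 0 j) * s).
have c'j : c' j 0 = - (qinv (A 0 j) * s) by rewrite mxE unlift_none.
have c'l l : c' (lift j l) 0 = c l 0 by rewrite mxE liftK.
exists c'.
  apply: contra_neq c0 => c'0; apply/matrixP => l k; rewrite ord1 -c'l c'0 !mxE //.
apply/matrixP => i k; rewrite ord1 !mxE (bigD1_ord j) //= c'j.
under eq_bigr do rewrite c'l.
case: (unliftP 0 i) => [i' ->|->]; last first.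
  by rewrite mulrN mulrA qmulV // mul1r addNr.
have /matrixP/(_ i' 0) := A'c; rewrite !mxE => e; rewrite -[RHS]e.
under [RHS]eq_bigr do rewrite [A' _ _]mxE mulrBl.
rewrite sumrB addrC mulrN; congr (_ - _).
by rewrite mulrA /s big_distrr; apply: eq_bigr => l _ /=; rewrite !mulrA.
Qed.

Lemma injmx_leq m n (A : 'M[H]_(m, n)) : injmx A -> (n <= m)%N.
Proof.
move=> injA; rewrite leqNgt; apply/negP => /(underdetermined A)[c c0 Ac].
by rewrite (injA c Ac) eqxx in c0.
Qed.

Lemma mx11_mulV (d : 'M[H]_1) : d != 0 -> exists e : 'M[H]_1, d *m e = 1%:M.
Proof.
move=> d0; have d00 : d 0 0 != 0.
  by apply: contra_neq d0 => d00; apply/matrixP => i j; rewrite !ord1 d00 mxE.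
exists (qinv (d 0 0))%:M; apply/matrixP => i j.
by rewrite !mxE big_ord1 !mxE !ord1 eqxx !mulr1n qmulV.
Qed.

Lemma injmx_row_mx m n (x : 'cV[H]_m) (A : 'M[H]_(m, n)) :
  injmx A -> (forall c, x <> A *m c) -> injmx (row_mx x A).
Proof.
move=> injA xA c; rewrite -[c](@vsubmxK _ 1 n) mul_row_col.
set d := usubmx _; set e := dsubmx _ => xde.
have [d0|d0] := eqVneq d 0.
  by move: xde; rewrite d0 mulmx0 add0r => /injA ->; rewrite col_mx0.
have [d' dd'] := mx11_mulV d0; case: (xA (- (e *m d'))).
apply/eqP; rewrite mulmxN -addr_eq0 mulmxA -{1}[x]mulmx1 -dd' mulmxA -mulmxDl.
by rewrite xde mul0mx.
Qed.

Lemma hermitian_inv n (G : 'M[H]_n) : qhermitian G -> injmx G ->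
  exists2 Gi : 'M[H]_n, Gi *m G = 1%:M & G *m Gi = 1%:M /\ qhermitian Gi.
Proof.
move=> hG injG.
have surjG (y : 'cV[H]_n) : exists c, y = G *m c.
  apply: contrapT => /forallNP ny.
  by have /injmx_leq := injmx_row_mx injG ny; rewrite ltnn.
have [f fP] := choice (fun j => surjG (col j 1%:M)).
pose X := \matrix_(i, j) f j i 0.
have GX : G *m X = 1%:M.
  apply/matrixP => i j; have /matrixP/(_ i 0) := fP j; rewrite !mxE => ->.
  by apply: eq_bigr => k _; rewrite mxE.
have XG : X^! *m G = 1%:M by rewrite -{1}hG -qadjM GX qadj1.
have XX : X^! = X by rewrite -[LHS]mulmx1 -GX mulmxA XG mul1mx.
by rewrite XX in XG; exists X.
Qed.

End QuaternionAlgebra.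

Section HermitianForms.
Variable R : realType.
Local Notation H := (quat R).

Definition qf n (M : 'M[H]_n) (x : 'cV_n) : R := q0 ((x^! *m M *m x) 0 0).

Lemma qf_mx n (M : 'M[H]_n) x : qhermitian M -> x^! *m M *m x = (realq (qf M x))%:M.
Proof.
move=> hM; apply/matrixP => i j; rewrite !ord1 [in RHS]mxE eqxx mulr1n.
by apply: qconj_fixed; rewrite -qadjE !qadjM qadjK hM mulmxA.
Qed.

Lemma hermitian_gram m n (M : 'M[H]_m) (A : 'M[H]_(m, n)) :
  qhermitian M -> qhermitian (A^! *m M *m A).
Proof. by move=> hM; rewrite /qhermitian !qadjM qadjK hM mulmxA. Qed.

Lemma hermitianN n (M : 'M[H]_n) : qhermitian M -> qhermitian (- M).
Proof. by move=> hM; rewrite /qhermitian raddfN /= hM. Qed.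

Lemma qf_gram m n (M : 'M[H]_m) (A : 'M[H]_(m, n)) c :
  qf M (A *m c) = qf (A^! *m M *m A) c.
Proof. by rewrite /qf qadjM !mulmxA. Qed.

Lemma qfN n (M : 'M[H]_n) x : qf (- M) x = - qf M x.
Proof. by rewrite /qf mulmxN mulNmx mxE raddfN. Qed.

Lemma qf0 n (M : 'M[H]_n) : qf M 0 = 0.
Proof. by rewrite /qf mulmx0 mxE. Qed.

Lemma orth_sym m n k (M : 'M[H]_m) (A : 'M[H]_(m, n)) (B : 'M[H]_(m, k)) :
  qhermitian M -> A^! *m M *m B = 0 -> B^! *m M *m A = 0.
Proof.
move=> hM /(congr1 (@qadj R _ _)).
by rewrite raddf0 !qadjM qadjK hM mulmxA.
Qed.

Lemma qfD n (M : 'M[H]_n) x y : qhermitian M ->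
  qf M (x + y) = qf M x + qf M y + 2 * q0 ((y^! *m M *m x) 0 0).
Proof.
move=> hM; have e : q0 ((x^! *m M *m y) 0 0) = q0 ((y^! *m M *m x) 0 0).
  by rewrite -q0_qconj -qadjE !qadjM qadjK hM mulmxA.
rewrite /qf [(x + y)^!]raddfD !mulmxDl !mulmxDr.
rewrite ![(_ + _ : 'M_1) 0 0]mxE !raddfD /= [q0 ((x^! *m M *m y) 0 0)]e mulr2n.
by ring.
Qed.

Lemma qfD_orth n (M : 'M[H]_n) x y : qhermitian M -> y^! *m M *m x = 0 ->
  qf M (x + y) = qf M x + qf M y.
Proof. by move=> hM yx; rewrite qfD // yx mxE mulr0 addr0. Qed.

Lemma qf_rscale n (M : 'M[H]_n) x (d : 'M[H]_1) : qhermitian M ->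
  qf M (x *m d) = qnorm (d 0 0) * qf M x.
Proof.
move=> hM; rewrite qf_gram qf_mx //; set a := qf M x.
rewrite /qf -mulmxA mul_scalar_mx realqZ_mulmx !mxE big_ord1 q0_realqM.
by rewrite qadjE qconj_mulL mulrC.
Qed.

Lemma qf_realqZ n (M : 'M[H]_n) (a : R) x : qf M (realq a *: x) = a ^+ 2 * qf M x.
Proof.
by rewrite /qf qadj_realqZ -!scalemxAl realqZ_mulmx scalerA !mxE -rmorphM q0_realqM.
Qed.

Lemma qf1E n (x : 'cV[H]_n) : qf 1%:M x = \sum_i qnorm (x i 0).
Proof.
rewrite /qf mulmx1 mxE raddf_sum; apply: eq_bigr => i _.
by rewrite qadjE qconj_mulL.
Qed.

Lemma qf1_ge0 n (x : 'cV[H]_n) : 0 <= qf 1%:M x.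
Proof. by rewrite qf1E; apply: sumr_ge0 => i _; apply: qnorm_ge0. Qed.

Lemma qf1_eq0 n (x : 'cV[H]_n) : qf 1%:M x = 0 -> x = 0.
Proof.
rewrite qf1E => /eqP; rewrite psumr_eq0 => [/allP x0|i _]; last exact: qnorm_ge0.
apply/matrixP => i j; rewrite ord1 mxE; apply/eqP; rewrite -qnorm_eq0.
by apply: (implyP (x0 i _)) => //; rewrite mem_index_enum.
Qed.

Lemma qf1_gt0 n (x : 'cV[H]_n) : x != 0 -> 0 < qf 1%:M x.
Proof. by move=> x0; rewrite lt_neqAle qf1_ge0 andbT eq_sym; apply: contra_neq x0 => /qf1_eq0. Qed.

Lemma qadj_mul_eq0 n k (A : 'M[H]_(n, k)) (c : 'cV_k) :
  A^! *m A *m c = 0 -> A *m c = 0.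
Proof.
by move=> AAc; apply: qf1_eq0; rewrite qf_gram mulmx1 /qf -mulmxA AAc mulmx0 mxE.
Qed.

Definition posfam n k (M : 'M[H]_n) (P : 'M[H]_(n, k)) :=
  forall c, c != 0 -> 0 < qf M (P *m c).

Lemma posfam_ge0 n k (M : 'M[H]_n) (P : 'M[H]_(n, k)) c :
  posfam M P -> 0 <= qf M (P *m c).
Proof.
move=> pP; have [->|c0] := eqVneq c 0; first by rewrite mulmx0 qf0.
exact/ltW/pP.
Qed.

Lemma posfam_inj n k (M : 'M[H]_n) (P : 'M[H]_(n, k)) : posfam M P -> injmx P.
Proof.
move=> pP c Pc; apply/eqP; rewrite -[_ == _]negbK; apply/negP => /pP.
by rewrite Pc qf0 ltxx.
Qed.

Lemma posfam_leq n k (M : 'M[H]_n) (P : 'M[H]_(n, k)) : posfam M P -> (k <= n)%N.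
Proof. by move=> /posfam_inj/injmx_leq. Qed.

Lemma posfam_void n (M : 'M[H]_n) : posfam M (0 : 'M[H]_(n, 0)).
Proof. by move=> c /eqP[]; apply/matrixP => -[]. Qed.

Lemma posfam_row n k (M : 'M[H]_n) (x : 'cV_n) (P : 'M[H]_(n, k)) :
  qhermitian M -> P^! *m M *m x = 0 -> 0 < qf M x -> posfam M P ->
  posfam M (row_mx x P).
Proof.
move=> hM Px x0 pP c; rewrite -[c](@vsubmxK _ 1 k) mul_row_col.
set d := usubmx _; set e := dsubmx _ => de0.
rewrite qfD_orth //; last first.
  transitivity (e^! *m (P^! *m M *m x) *m d); first by rewrite qadjM !mulmxA.
  by rewrite Px mulmx0 mul0mx.
rewrite qf_rscale //; have [d0|d0] := eqVneq d 0.
  rewrite d0 mxE qnorm0 mul0r add0r; apply: pP.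
  by apply: contra_neq de0 => ->; rewrite d0 col_mx0.
apply: ltr_pwDl; last exact: posfam_ge0.
rewrite mulr_gt0 // qnorm_gt0 //; apply: contra_neq d0 => d0.
by apply/matrixP => i j; rewrite !ord1 d0 mxE.
Qed.

Lemma nonisotropic n k (M : 'M[H]_n) (A : 'M[H]_(n, k)) (x : 'cV_n) :
  qhermitian M -> injmx M -> injmx (A^! *m M *m A) ->
  x != 0 -> A^! *m M *m x = 0 ->
  exists2 y : 'cV_n, A^! *m M *m y = 0 & qf M y != 0.
Proof.
move=> hM injM injG x0 Ax.
have [Gi GiG [GGi hGi]] := hermitian_inv (hermitian_gram A hM) injG.
have [x1|x1] := eqVneq (qf M x) 0; last by exists x.
pose z := M *m x; pose y := z - A *m (Gi *m (A^! *m M *m z)).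
have z0 : z != 0 by apply: contra_neq x0 => /injM.
have Ay : A^! *m M *m y = 0 by rewrite mulmxBr !mulmxA GGi mul1mx subrr.
have [y1|y1] := eqVneq (qf M y) 0; last by exists y.
exists (x + y); first by rewrite mulmxDr Ax Ay addr0.
rewrite qfD // x1 y1 !add0r mulf_neq0 ?pnatr_eq0 //.
suff -> : q0 ((y^! *m M *m x) 0 0) = qf 1%:M z by rewrite gt_eqF // qf1_gt0.
rewrite raddfB /= !mulmxBl !qadjM -!mulmxA qadjK hM [A^! *m (M *m x)]mulmxA Ax.
by rewrite !mulmx0 subr0 /qf mulmx1 /z qadjM hM !mulmxA.
Qed.

Lemma exists_max (P : nat -> Prop) m : P 0%N -> (forall k, P k -> (k <= m)%N) ->
  exists2 k, P k & forall l, P l -> (l <= k)%N.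
Proof.
move=> P0 Pm; have ex : exists k, `[< P k >] by exists 0%N; apply/asboolP.
have bd k : `[< P k >] -> (k <= m)%N by move=> /asboolP/Pm.
case: (ex_maxnP ex bd) => k /asboolP Pk max.
by exists k => // l Pl; apply: max; apply/asboolP.
Qed.

Definition pos_index n (M : 'M[H]_n) (p : nat) :=
  (exists P : 'M[H]_(n, p), posfam M P) /\
  (forall k (P : 'M[H]_(n, k)), posfam M P -> (k <= p)%N).

Lemma pos_index_max n (M : 'M[H]_n) p (P : 'M[H]_(n, p)) x :
  qhermitian M -> pos_index M p -> posfam M P -> P^! *m M *m x = 0 -> qf M x <= 0.
Proof.
move=> hM [_ max] pP Px; rewrite leNgt; apply/negP => x0.
by have := max _ _ (posfam_row hM Px x0 pP); rewrite ltnn.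
Qed.

Lemma exists_pos_index n (M : 'M[H]_n) : exists p, pos_index M p.
Proof.
have [||p ex max] := @exists_max (fun p => exists P : 'M[H]_(n, p), posfam M P) n.
- by exists 0; apply: posfam_void.
- by move=> k [P /posfam_leq].
by exists p; split=> // k P pP; apply: max; exists P.
Qed.

(* Take [P] positive definite of maximal size and [N] negative definite of
   maximal size among those orthogonal to [P]: a nonzero vector orthogonal to
   both would yield a nonisotropic one, contradicting one of the maximalities. *)
Lemma pos_indexN n (M : 'M[H]_n) p : qhermitian M -> injmx M ->
  pos_index M p -> pos_index (- M) (n - p).
Proof.
move=> hM injM iM; have hN := hermitianN hM; have [[P pP] maxP] := iM.
pose good q := exists2 N : 'M[H]_(n, q), posfam (- M) N & P^! *m M *m N = 0.
have disj k (N : 'M[H]_(n, k)) : posfam (- M) N -> (p + k <= n)%N.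
  move=> pN; suff /injmx_leq : injmx (row_mx P N) by [].
  move=> c; rewrite -[c]vsubmxK mul_row_col.
  set d := usubmx c; set e := dsubmx c => PdNe.
  have Pd : P *m d = - (N *m e) by apply/eqP; rewrite -addr_eq0 PdNe.
  have qfPd : qf M (P *m d) = qf M (N *m e).
    by rewrite Pd /qf [(- (N *m e))^!]raddfN /= !mulNmx mulmxN opprK.
  have := posfam_ge0 e pN; rewrite qfN -qfPd oppr_ge0 => Pd0.
  have d0 : d = 0.
    by apply/eqP; rewrite -[_ == _]negbK; apply/negP => /pP; rewrite ltNge Pd0.
  move: PdNe; rewrite d0 mulmx0 add0r => /(posfam_inj pN) ->.
  by rewrite col_mx0.
have [||q [N pN PN] maxN] := @exists_max good n.
- by exists 0; [apply: posfam_void|rewrite mulmx0].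
- by move=> k [N /posfam_leq].
have NP := orth_sym hM PN.
suff npq : (n <= p + q)%N.
  have pqn : (n - p = q)%N.
    by apply/eqP; rewrite eqn_leq leq_subLR npq leq_subRL ?disj //=
      (leq_trans _ (disj _ _ pN)) ?leq_addr.
  rewrite pqn; split; first by exists N.
  by move=> k L /disj; rewrite -pqn => pkn; rewrite leq_subRL // (leq_trans _ pkn) // leq_addr.
rewrite leqNgt; apply/negP => pqn.
pose A := row_mx P N.
have [x x0 Ax] := underdetermined (A^! *m M) pqn.
have injG : injmx (A^! *m M *m A).
  move=> c; rewrite -[c]vsubmxK; set d := usubmx c; set e := dsubmx c.
  rewrite qadj_row_mx mul_col_mx mul_col_row PN NP mul_block_col !mul0mx addr0 add0r.
  rewrite -[0](@col_mx0 _ p q) => /eq_col_mx[Pd Ne]; congr col_mx.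
    apply/eqP; rewrite -[_ == _]negbK; apply/negP => /pP.
    by rewrite qf_gram /qf -mulmxA Pd mulmx0 mxE ltxx.
  apply/eqP; rewrite -[_ == _]negbK; apply/negP => /pN.
  by rewrite qfN qf_gram /qf -mulmxA Ne mulmx0 mxE oppr0 ltxx.
have [y] := nonisotropic hM injM injG x0 Ax.
rewrite qadj_row_mx !mul_col_mx -[0](@col_mx0 _ p q) => /eq_col_mx[Py Ny] yn.
have y1 : qf M y < 0 by rewrite lt_neqAle yn (pos_index_max hM iM pP).
suff /maxN : good q.+1 by rewrite ltnn.
exists (row_mx y N); last by rewrite [LHS](mul_mx_row (P^! *m M) y N) Py PN row_mx0.
apply: posfam_row => //; last by rewrite qfN oppr_gt0.
by rewrite mulmxN mulNmx Ny oppr0.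
Qed.
End HermitianForms.

Section WittExtension.
Variable R : realType.
Local Notation H := (quat R).

(* With [a] the positive index of the common Gram matrix, [A] and [x] give
   [a < p]; were the form nonpositive on the complement of [B], every positive
   definite family of [H2] would have at most [a] members. *)
Lemma orthogonal_posvec n k (H1 H2 : 'M[H]_n) p (A B : 'M[H]_(n, k)) (x : 'cV_n) :
  qhermitian H1 -> qhermitian H2 -> pos_index H1 p -> pos_index H2 p ->
  A^! *m H1 *m A = B^! *m H2 *m B -> injmx (A^! *m H1 *m A) ->
  A^! *m H1 *m x = 0 -> 0 < qf H1 x ->
  exists2 y, B^! *m H2 *m y = 0 & 0 < qf H2 y.
Proof.
move=> h1 h2 i1 [[Q pQ] _] AB injG Ax x0; set G := A^! *m H1 *m A in AB injG.
have hG : qhermitian G by apply: hermitian_gram.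
have [Gi GiG [GGi hGi]] := hermitian_inv hG injG.
have [a iG] := exists_pos_index G; have [[C pC] _] := iG.
have ap : (a < p)%N.
  apply: (i1.2 _ (row_mx x (A *m C))); apply: posfam_row => //.
    by rewrite qadjM -!mulmxA (mulmxA _ _ x) Ax mulmx0.
  by move=> c c0; rewrite -mulmxA qf_gram; apply: pC.
have [c c0 Qc] := underdetermined (C^! *m B^! *m H2 *m Q) ap.
pose u := Q *m c; pose g := Gi *m (B^! *m H2 *m u); pose y := u - B *m g.
have By : B^! *m H2 *m y = 0 by rewrite mulmxBr !mulmxA -AB GGi mul1mx subrr.
exists y => //.
have Cg : C^! *m G *m g = 0 by rewrite -mulmxA [G *m g]mulmxA GGi mul1mx !mulmxA.
have g0 : qf G g <= 0 by apply: pos_index_max Cg.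
have : 0 < qf H2 (B *m g + y) by rewrite addrC subrK; apply: pQ.
rewrite addrC qfD_orth //; last by rewrite qadjM -!mulmxA (mulmxA _ _ y) By mulmx0.
by rewrite [qf _ (B *m g)]qf_gram -AB => /lt_le_trans; apply; rewrite gerDl.
Qed.

Definition extension n k (H1 H2 : 'M[H]_n) (A B : 'M[H]_(n, k)) :=
  exists x y : 'cV_n, [/\ A^! *m H1 *m x = B^! *m H2 *m y, qf H1 x = qf H2 y,
    forall c, x <> A *m c & forall c, y <> B *m c].

Lemma extension_regular_pos n k (H1 H2 : 'M[H]_n) p (A B : 'M[H]_(n, k)) (x : 'cV_n) :
  qhermitian H1 -> qhermitian H2 -> pos_index H1 p -> pos_index H2 p ->
  A^! *m H1 *m A = B^! *m H2 *m B -> injmx (A^! *m H1 *m A) ->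
  A^! *m H1 *m x = 0 -> 0 < qf H1 x -> extension H1 H2 A B.
Proof.
move=> h1 h2 i1 i2 AB injG Ax x0.
have [y By y0] := orthogonal_posvec h1 h2 i1 i2 AB injG Ax x0.
have ab0 : 0 < qf H1 x / qf H2 y by rewrite divr_gt0.
exists x, (realq (Num.sqrt (qf H1 x / qf H2 y)) *: y); split.
- by rewrite realqZ_mulmx By scaler0.
- by rewrite qf_realqZ sqr_sqrtr ?(ltW ab0) // divfK // gt_eqF.
- by move=> c xc; move: Ax x0; rewrite xc mulmxA => /injG ->; rewrite mulmx0 qf0 ltxx.
move=> c yc; move: y0; set b := realq _ in yc.
have b0 : Num.sqrt (qf H1 x / qf H2 y) != 0 by rewrite gt_eqF // sqrtr_gt0.
have : B^! *m H2 *m (B *m c) = 0 by rewrite -yc realqZ_mulmx By scaler0.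
rewrite mulmxA -AB => /injG c0; move: yc; rewrite c0 mulmx0 => /(congr1 (qf H2)).
rewrite qf0 qf_realqZ => /eqP; rewrite mulf_eq0 expf_eq0 /= (negPf b0) /= => /eqP ->.
by rewrite ltxx.
Qed.

Lemma extensionN n k (H1 H2 : 'M[H]_n) (A B : 'M[H]_(n, k)) :
  extension (- H1) (- H2) A B -> extension H1 H2 A B.
Proof.
move=> [x [y [xy e xA yB]]]; exists x, y; split=> //.
  by move: xy; rewrite !mulmxN !mulNmx => /oppr_inj.
by apply: oppr_inj; rewrite -!qfN.
Qed.

Lemma injmxN m n (A : 'M[H]_(m, n)) : injmx A -> injmx (- A).
Proof. by move=> injA c; rewrite mulNmx => /eqP; rewrite oppr_eq0 => /eqP/injA. Qed.

Lemma extension_regular n k (H1 H2 : 'M[H]_n) p (A B : 'M[H]_(n, k)) (x : 'cV_n) :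
  qhermitian H1 -> qhermitian H2 -> injmx H1 -> injmx H2 ->
  pos_index H1 p -> pos_index H2 p ->
  A^! *m H1 *m A = B^! *m H2 *m B -> injmx (A^! *m H1 *m A) ->
  x != 0 -> A^! *m H1 *m x = 0 -> extension H1 H2 A B.
Proof.
move=> h1 h2 inj1 inj2 i1 i2 AB injG x0 Ax.
have [y Ay] := nonisotropic h1 inj1 injG x0 Ax.
rewrite neq_lt => /orP[yn|yp]; last first.
  exact: (extension_regular_pos h1 h2 i1 i2 AB injG Ay yp).
apply: extensionN.
apply: (extension_regular_pos (x := y) (hermitianN h1) (hermitianN h2)
  (pos_indexN h1 inj1 i1) (pos_indexN h2 inj2 i2)).
- by rewrite !mulmxN !mulNmx AB.
- by rewrite mulmxN mulNmx; apply: injmxN.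
- by rewrite mulmxN mulNmx Ay oppr0.
by rewrite qfN oppr_gt0.
Qed.

Lemma surj_adj n k (B : 'M[H]_(n, k)) :
  injmx B -> exists C : 'M[H]_(n, k), B^! *m C = 1%:M.
Proof.
move=> injB.
have [||E _ [BE _]] := @hermitian_inv R _ (B^! *m B).
- by rewrite /qhermitian qadjM qadjK.
- by move=> c /qadj_mul_eq0/injB.
by exists (B *m E); rewrite mulmxA.
Qed.

Lemma extension_singular n k (H1 H2 : 'M[H]_n) (A B : 'M[H]_(n, k)) :
  qhermitian H1 -> qhermitian H2 -> injmx H1 -> injmx H2 ->
  injmx A -> injmx B -> A^! *m H1 *m A = B^! *m H2 *m B ->
  ~ injmx (A^! *m H1 *m A) -> extension H1 H2 A B.
Proof.
move=> h1 h2 inj1 inj2 injA injB AB /existsNP[c /not_implyP[Gc c0]].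
pose r := A *m c; pose x := H1 *m r.
have r0 : r <> 0 by move=> /injA.
have [J _ [H2J _]] := hermitian_inv h2 inj2.
have [C BC] := surj_adj injB.
pose s := B *m c; pose y0 := J *m C *m A^! *m H1 *m x.
have By0 : B^! *m H2 *m y0 = A^! *m H1 *m x.
  by rewrite /y0 !mulmxA -[B^! *m H2 *m J]mulmxA H2J mulmx1 BC mul1mx.
have Bs : B^! *m H2 *m s = 0 by rewrite mulmxA -AB.
have s0 : qf H2 s = 0 by rewrite qf_gram -AB /qf -mulmxA Gc mulmx0 mxE.
have x0 : x != 0 by apply/eqP => /inj1.
have xx0 : x^! *m x <> 0.
  move=> xx; move: x0 => /qf1_gt0; rewrite /qf mulmx1 xx mxE /=.
  by rewrite ltxx.
have sy : s^! *m H2 *m y0 = x^! *m x.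
  by rewrite qadjM -!mulmxA (mulmxA B^!) By0 [x^!]qadjM h1 qadjM !mulmxA.
(* The isotropic vector [s] is orthogonal to the image of [B], so adding a
   multiple of it only changes the value of the form at [y0]. *)
pose a := (qf H1 x - qf H2 y0) / (2 * qf 1%:M x).
exists x, (realq a *: s + y0); split.
- by rewrite mulmxDr realqZ_mulmx Bs scaler0 add0r By0.
- have qx : q0 ((x^! *m x) 0 0) = qf 1%:M x by rewrite /qf mulmx1.
  have nx : qf 1%:M x != 0 by rewrite gt_eqF // qf1_gt0.
  have -> : realq a *: s + y0 = y0 + realq a *: s by rewrite addrC.
  rewrite qfD // qf_realqZ s0 qadj_realqZ -!scalemxAl sy mxE q0_realqM qx.
  by rewrite /a; field.
- move=> d xd; have xA : x^! *m A = 0.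
    by rewrite -[LHS]qadjK qadjM qadjK !mulmxA Gc raddf0.
  by apply: xx0; rewrite {2}xd mulmxA xA mul0mx.
move=> d yd; apply: xx0; rewrite -sy.
have -> : y0 = B *m d - realq a *: s by rewrite -yd addrC addKr.
have sB : s^! *m H2 *m B = 0 by apply: orth_sym.
by rewrite mulmxBr realqZ_mulmx {2}/s !mulmxA sB !mul0mx scaler0 subr0.
Qed.

Lemma gram_row_mx n k l (M : 'M[H]_n) (x : 'M[H]_(n, l)) (A : 'M[H]_(n, k)) :
  (row_mx x A)^! *m M *m row_mx x A =
  block_mx (x^! *m M *m x) (x^! *m M *m A) (A^! *m M *m x) (A^! *m M *m A).
Proof. by rewrite qadj_row_mx mul_col_mx mul_col_row. Qed.

Lemma witt_mx n k (H1 H2 : 'M[H]_n) p (A B : 'M[H]_(n, k)) :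
  qhermitian H1 -> qhermitian H2 -> injmx H1 -> injmx H2 ->
  pos_index H1 p -> pos_index H2 p ->
  injmx A -> injmx B -> A^! *m H1 *m A = B^! *m H2 *m B ->
  exists2 U : 'M[H]_n, U *m A = B & U^! *m H2 *m U = H1.
Proof.
move=> h1 h2 inj1 inj2 i1 i2; have [m] := ubnP (n - k); elim: m k A B => // m IH k A B.
move=> nkm injA injB AB.
have extend : extension H1 H2 A B ->
    exists2 U : 'M[H]_n, U *m A = B & U^! *m H2 *m U = H1.
  move=> [x [y [xy e xA yB]]].
  have inj_xA := injmx_row_mx injA xA.
  have [||||U UA UH] := IH k.+1 (row_mx x A) (row_mx y B).
  - have kn : (k < n)%N := injmx_leq inj_xA.
    by move: nkm; rewrite ltnS; apply: leq_trans; rewrite ltn_sub2l.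
  - by [].
  - exact: injmx_row_mx.
  - rewrite [LHS](gram_row_mx H1 x A) [RHS](gram_row_mx H2 y B).
    have yx : x^! *m H1 *m A = y^! *m H2 *m B.
      by apply: (can_inj (@qadjK _ _ _)); rewrite !qadjM !qadjK h1 h2 !mulmxA.
    by rewrite xy yx AB !qf_mx // e.
  exists U => //; move: (etrans (esym (mul_mx_row U x A)) UA).
  by case/eq_row_mx.
have [injG|singG] := pselect (injmx (A^! *m H1 *m A)); last first.
  by apply: extend; apply: extension_singular.
have [[x x0 Ax]|perp0] := pselect (exists2 x : 'cV_n, x != 0 & A^! *m H1 *m x = 0).
  by apply: extend; apply: extension_regular i1 i2 AB injG x0 Ax.
have [Gi GiG [GGi hGi]] := hermitian_inv (hermitian_gram A h1) injG.
pose K := Gi *m A^! *m H1.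
have AK : A *m K = 1%:M.
  apply/eqP; rewrite eq_sym -subr_eq0; apply/eqP/matrixP => i j.
  have : col j (1%:M - A *m K) = 0.
    apply/eqP; rewrite -[_ == _]negbK; apply/negP => cj0; apply: perp0.
    exists (col j (1%:M - A *m K)) => //.
    by rewrite colE mulmxA mulmxBr mulmx1 !mulmxA GGi mul1mx subrr mul0mx.
  by move=> /matrixP/(_ i 0); rewrite !mxE.
exists (B *m K); first by rewrite /K -!mulmxA [A^! *m _]mulmxA GiG mulmx1.
transitivity (K^! *m (B^! *m H2 *m B) *m K); first by rewrite qadjM !mulmxA.
rewrite -AB; transitivity ((A *m K)^! *m H1 *m (A *m K)).
  by rewrite qadjM !mulmxA.
by rewrite AK qadj1 mul1mx mulmx1.
Qed.
End WittExtension.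

Section SpectralBound.
Variable R : realType.
Local Notation H := (quat R).

Lemma real_poly_factor (p : {poly R}) : (1 < size p)%N ->
  (exists a q, p = q * ('X - a%:P)) \/
  (exists a b q, b != 0 /\ p = q * (('X - a%:P) ^+ 2 + (b ^+ 2)%:P)).
Proof.
move=> sp; have [[a /factor_theorem[q pq]]|nr] := pselect (exists a, root p a).
  by left; exists a, q.
right; pose toC := real_complex R.
have : size (map_poly toC p) != 1%N by rewrite size_map_poly gtn_eqF.
case/closed_rootP => -[a b] pz.
have b0 : b != 0.
  apply/eqP => b0; apply: nr; exists a; rewrite b0 in pz.
  by rewrite -(fmorph_root toC).
pose q := ('X - a%:P) ^+ 2 + (b ^+ 2)%:P.
have qE : q = (('X - (a *+ 2)%:P) * 'X + (a ^+ 2 + b ^+ 2)%:P).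
  by rewrite /q; ring.
have sq : size q = 3%N.
  by rewrite qE size_MXaddC polyXsubC_eq0 /= size_XsubC.
exists a, b, (p %/ q); split => //; rewrite -/q {1}(divp_eq p q).
suff -> : p %% q = 0 by rewrite addr0.
set r := p %% q.
have sr : (size r <= 2)%N by rewrite -ltnS -sq ltn_modp -size_poly_eq0 sq.
have qz : (map_poly toC q).[Complex a b] = 0.
  rewrite rmorphD rmorphXn rmorphB /= map_polyX !map_polyC /= !hornerE /=.
  by apply/eqP; rewrite eq_complex /=; apply/andP; split; apply/eqP; ring.
have rz : (map_poly toC r).[Complex a b] = 0.
  have := pz; rewrite /root {1}(divp_eq p q) -/r rmorphD rmorphM hornerD hornerM.
  by rewrite qz mulr0 add0r => /eqP.
move: rz; rewrite (@horner_coef_wide _ 2) ?size_map_poly // !big_ord_recl big_ord0 /=.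
rewrite !coef_map /= expr0 mulr1 addr0 expr1 => /eqP; rewrite eq_complex /=.
rewrite /bump /= addn0 => /andP[/eqP re /eqP im].
have r1 : r`_1 = 0.
  by apply: (mulIf b0); rewrite mul0r; apply: etrans im; ring.
have r0 : r`_0 = 0 by apply: etrans re; rewrite r1; ring.
apply/polyP => -[|[|i]]; rewrite coef0 //.
by rewrite nth_default // (leq_trans sr).
Qed.

Lemma q0DZ (X Y : 'M[H]_1) a :
  q0 ((X + realq a *: Y) 0 0) = q0 (X 0 0) + a * q0 (Y 0 0).
Proof. by rewrite !mxE -q0_realqM; exact: raddfD. Qed.

Section Evaluation.
Variables (n : nat) (M : 'M[H]_n.+1).

Lemma comm_real_scalar : commr_rmorph (@scalar_mx H n.+1 \o @realq R) M.
Proof.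
move=> a; rewrite /GRing.comm /= -[LHS]/(M *m (realq a)%:M) -[RHS]/((realq a)%:M *m M).
by rewrite -scalemx1 realqZ_mulmx mulmx1 scalemx1 mul_scalar_mx.
Qed.

Definition peval (p : {poly R}) : 'M[H]_n.+1 := horner_morph comm_real_scalar p.

HB.instance Definition _ := GRing.RMorphism.copy peval (horner_morph comm_real_scalar).

Lemma pevalX : peval 'X = M. Proof. exact: horner_morphX. Qed.

Lemma pevalC a : peval a%:P = (realq a)%:M.
Proof. exact: (horner_morphC comm_real_scalar). Qed.

Lemma pevalM p q : peval (p * q) = peval p *m peval q.
Proof. exact: rmorphM. Qed.

Lemma pevalMX p : peval (p * 'X) = peval p *m M.
Proof. by rewrite pevalM pevalX. Qed.

Lemma annihilating_poly (x : 'cV_n.+1) : exists2 p : {poly R}, p != 0 & peval p *m x = 0.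
Proof.
pose N := (n.+1 + n.+1 + (n.+1 + n.+1))%N.
pose K (f : H -> R) : 'M[R]_(N.+1, n.+1) :=
  \matrix_(i, l) f ((M ^+ i *m x) l 0).
pose KK : 'M_(N.+1, N) := row_mx (row_mx (K (@q0 R)) (K (@q1 R)))
  (row_mx (K (@q2 R)) (K (@q3 R))).
have : kermx KK != 0.
  by rewrite -mxrank_eq0 mxrank_ker subn_eq0 -ltnNge ltnS rank_leq_col.
case/rowV0Pn => c /sub_kermxP; rewrite !mul_mx_row => cK c0.
have [c01 c23] : row_mx (c *m K (@q0 R)) (c *m K (@q1 R)) = 0 /\
    row_mx (c *m K (@q2 R)) (c *m K (@q3 R)) = 0.
  by apply: eq_row_mx; rewrite cK row_mx0.
have [cK0 cK1] : c *m K (@q0 R) = 0 /\ c *m K (@q1 R) = 0.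
  by apply: eq_row_mx; rewrite c01 row_mx0.
have [cK2 cK3] : c *m K (@q2 R) = 0 /\ c *m K (@q3 R) = 0.
  by apply: eq_row_mx; rewrite c23 row_mx0.
exists (rVpoly c); first by apply: contra_neq c0 => c0; rewrite -[c]rVpolyK c0 linear0.
have pc : peval (rVpoly c) *m x = \sum_(i < N.+1) realq (c 0 i) *: (M ^+ i *m x).
  rewrite /rVpoly poly_def raddf_sum mulmx_suml; apply: eq_bigr => i _ /=.
  by rewrite valK -mul_polyC pevalM pevalC rmorphXn /= pevalX mul_scalar_mx -scalemxAl.
rewrite pc; apply/matrixP => l j; rewrite ord1 summxE [RHS]mxE; apply: quatP.
have aux (f : {additive H -> R}) : (forall a p, f (realq a * p) = a * f p) ->
    c *m K f = 0 -> f (\sum_(i < N.+1) (realq (c 0 i) *: (M ^+ i *m x)) l 0) = 0.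
  move=> fZ /matrixP/(_ 0 l); rewrite mxE [RHS]mxE => <-; rewrite raddf_sum.
  by apply: eq_bigr => i _; rewrite !mxE fZ.
by split; [apply: (aux (@q0 R))|apply: (aux (@q1 R))|apply: (aux (@q2 R))
  |apply: (aux (@q3 R))] => // a p /=; ring.
Qed.

Lemma peval_eigen p a k (y : 'M_(n.+1, k)) :
  M *m y = realq a *: y -> peval p *m y = realq p.[a] *: y.
Proof.
move=> My; elim/poly_ind: p => [|p c IH].
  by rewrite [peval 0]raddf0 mul0mx horner0 raddf0 scale0r.
rewrite [peval _]raddfD /= pevalMX pevalC mulmxDl -mulmxA My realqZ_mulmx IH.
by rewrite mul_scalar_mx scalerA -rmorphM -scalerDl -rmorphD hornerMXaddC mulrC.
Qed.

Lemma peval_herm p : qhermitian M -> qhermitian (peval p).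
Proof.
move=> hM; rewrite /qhermitian; elim/poly_ind: p => [|p c IH].
  by rewrite [peval 0]raddf0 raddf0.
have hc : ((realq c)%:M : 'M_n.+1)^! = (realq c)%:M.
  by rewrite -scalemx1 qadj_realqZ qadj1.
rewrite [peval _]raddfD /= raddfD /= pevalC hc pevalMX qadjM IH hM.
by rewrite -pevalMX mulrC pevalM pevalX.
Qed.

Lemma peval_stable k (P : 'M_(n.+1, k)) p (x : 'cV_n.+1) :
  (forall x : 'cV_n.+1, P^! *m x = 0 -> P^! *m (M *m x) = 0) ->
  P^! *m x = 0 -> P^! *m (peval p *m x) = 0.
Proof.
move=> stP; elim/poly_ind: p x => [|p c IH] x Px.
  by rewrite [peval 0]raddf0 mul0mx mulmx0.
rewrite [peval _]raddfD /= pevalMX pevalC mulmxDl mulmxDr -mulmxA IH ?stP // add0r.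
by rewrite mul_scalar_mx realqZ_mulmx Px scaler0.
Qed.

Lemma pevalXsub a : peval ('X - a%:P) = M - (realq a)%:M.
Proof. by rewrite [LHS]raddfB /= pevalX pevalC. Qed.

(* Induction on a real polynomial [p] annihilating [x]: quadratic factors and
   repeated roots of [p] are redundant because [M] is Hermitian, and a simple
   root [a] splits off from [x] its component in the eigenspace of [a]. *)
Lemma qf_le0 k (P : 'M_(n.+1, k)) (x : 'cV_n.+1) : qhermitian M ->
  (forall x : 'cV_n.+1, P^! *m x = 0 -> P^! *m (M *m x) = 0) ->
  (forall a (x : 'cV_n.+1), 0 < a -> P^! *m x = 0 -> M *m x = realq a *: x -> x = 0) ->
  P^! *m x = 0 -> qf M x <= 0.
Proof.
move=> hM stP noeig; have [p p0 px] := annihilating_poly x.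
have [m] := ubnP (size p); elim: m p p0 x px => // m IH p p0 x px sp Px.
have [sp1|sp1] := leqP (size p) 1.
  move: p0 px; rewrite (size1_polyC sp1) polyC_eq0 pevalC; move: p`_0 => c c0.
  rewrite mul_scalar_mx => /(congr1 (fun y => realq c^-1 *: y)).
  by rewrite scalerA -rmorphM mulVf // rmorph1 scale1r scaler0 => ->; rewrite qf0.
have reduce q d : q * d = p -> (1 < size d)%N -> peval q *m x = 0 -> qf M x <= 0.
  move=> qd sd qx; have q0 : q != 0 by apply: contra_neq p0 => q0; rewrite -qd q0 mul0r.
  have d0 : d != 0 by rewrite -size_poly_gt0 ltnW.
  apply: (IH q) => //; move: sp; rewrite -qd size_mul // ltnS; apply: leq_trans.
  by case: (size d) sd => // [[|s]] // _; rewrite addnS /= addnS ltnS leq_addr.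
have [[a [q pq]]|[a [b [q [b0 pq]]]]] := real_poly_factor sp1; pose y := peval q *m x.
  have [y0|y0] := eqVneq y 0; first by apply: (reduce q ('X - a%:P)); rewrite ?size_XsubC.
  have My0 : (M - (realq a)%:M) *m y = 0.
    by rewrite -pevalXsub mulmxA -pevalM mulrC -pq.
  have My : M *m y = realq a *: y.
    by apply/eqP; rewrite -subr_eq0 -mul_scalar_mx -mulmxBl My0.
  have Py : P^! *m y = 0 by apply: peval_stable.
  have [qa|qa] := eqVneq q.[a] 0.
    case/eqP: y0; apply: qf1_eq0.
    have /factor_theorem[q' qq'] : root q a by apply/eqP.
    rewrite /qf mulmx1 {1}/y qq' mulrC pevalM -mulmxA qadjM pevalXsub.
    rewrite -pevalXsub (peval_herm _ hM) pevalXsub -mulmxA.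
    by rewrite My0 mulmx0 mxE.
  pose x' := x - realq q.[a]^-1 *: y.
  have qx' : peval q *m x' = 0.
    by rewrite mulmxBr realqZ_mulmx (peval_eigen _ My) scalerA -rmorphM mulVf //
      rmorph1 scale1r subrr.
  have Px' : P^! *m x' = 0 by rewrite mulmxBr realqZ_mulmx Px Py scaler0 subr0.
  have x'le0 : qf M x' <= 0.
    have q0 : q != 0 by apply: contra_neq qa => ->; rewrite horner0.
    by apply: (IH q) => //; move: sp; rewrite pq size_Mmonic ?monicXsubC // size_XsubC addn2.
  have yx' : y^! *m x' = 0.
    have : (peval q *m y)^! *m x' = 0 by rewrite qadjM (peval_herm _ hM) -mulmxA qx' mulmx0.
    rewrite (peval_eigen _ My) qadj_realqZ -scalemxAl => /(congr1 (fun z => realq q.[a]^-1 *: z)).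
    by rewrite scalerA -rmorphM mulVf // rmorph1 scale1r scaler0.
  have yMx' : y^! *m M *m x' = 0.
    by rewrite -{1}hM -qadjM My qadj_realqZ -scalemxAl yx' scaler0.
  have -> : x = x' + realq q.[a]^-1 *: y by rewrite subrK.
  rewrite qfD_orth //; last by rewrite qadj_realqZ -!scalemxAl yMx' scaler0.
  rewrite -[0]addr0 lerD // qf_realqZ mulr_ge0_le0 ?sqr_ge0 //.
  have [a0|a0] := ltP 0 a; first by rewrite (noeig _ _ a0 Py My) eqxx in y0.
  rewrite /qf -mulmxA My realqZ_mulmx mxE q0_realqM mulr_le0_ge0 //.
  by have := qf1_ge0 y; rewrite /qf mulmx1.
have y0 : y = 0.
  have : qf 1%:M (peval ('X - a%:P) *m y) + b ^+ 2 * qf 1%:M y = 0.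
    transitivity (q0 ((y^! *m (peval (('X - a%:P) ^+ 2 + (b ^+ 2)%:P) *m y)) 0 0)).
      rewrite /qf !mulmx1 qadjM (peval_herm _ hM) [peval (_ ^+ 2 + _)]raddfD /= pevalC.
      rewrite expr2 pevalM mulmxDl mulmxDr mul_scalar_mx realqZ_mulmx.
      by rewrite !mulmxA q0DZ.
    have -> : peval (('X - a%:P) ^+ 2 + (b ^+ 2)%:P) *m y = 0.
      by rewrite mulmxA -pevalM mulrC -pq.
    by rewrite mulmx0 mxE.
  move/eqP; rewrite paddr_eq0 ?qf1_ge0 ?(mulr_ge0 (sqr_ge0 b) (qf1_ge0 y)) //.
  by rewrite mulf_eq0 expf_eq0 /= (negPf b0) /= => /andP[_ /eqP/qf1_eq0].
apply: reduce (esym pq) _ y0.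
by rewrite size_polyDl size_exp_XsubC // size_polyC; case: eqP.
Qed.
End Evaluation.
End SpectralBound.

Section Inertia.
Variable R : realType.
Local Notation H := (quat R).

Lemma mulmx_rscale n k (A : 'M[H]_(n, k)) (c : 'cV_k) :
  A *m c = \sum_j rscale (col j A) (c j 0).
Proof.
apply/matrixP => i j; rewrite ord1 summxE mxE; apply: eq_bigr => l _.
by rewrite !mxE.
Qed.

Lemma rindep_col n k (A : 'M[H]_(n, k)) : rindep (fun j => col j A) <-> injmx A.
Proof.
split=> [ind c Ac|inj c].
  by apply/matrixP => i j; rewrite ord1 mxE; apply: (ind (c^~ 0)); rewrite -mulmx_rscale.
move=> Ac j; suff /matrixP/(_ j 0) : \col_i c i = 0 by rewrite !mxE.
apply: inj; rewrite mulmx_rscale -[RHS]Ac; apply: eq_bigr => i _.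
by rewrite mxE.
Qed.

Lemma dim_is_basis n (S : 'cV[H]_n -> Prop) d : dim_is S d ->
  exists E : 'M[H]_(n, d), [/\ injmx E, forall j, S (col j E)
    & forall x, S x -> exists c, x = E *m c].
Proof.
move=> [[v [Sv /= iv]] max]; pose E : 'M[H]_(n, d) := \matrix_(i, j) v j i 0.
have Ev j : col j E = v j by apply/matrixP => i k; rewrite ord1 !mxE.
have injE : injmx E.
  by apply/rindep_col => c cE; apply: iv; rewrite -[RHS]cE; apply: eq_bigr => j _; rewrite Ev.
exists E; split=> [||x Sx] //; first by move=> j; rewrite Ev.
apply: contrapT => /forallNP xE.
apply: (max (fun j => col j (row_mx x E))); last exact/rindep_col/injmx_row_mx.
move=> j; have [u ->|u ->] := split_ordP (j : 'I_(1 + d)).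
  by rewrite (@colKl _ n 1 d) [u]ord1 (_ : col 0 x = x) //; apply/matrixP => i k; rewrite ord1 mxE.
by rewrite (@colKr _ n 1 d) Ev.
Qed.

Lemma eigen_orth n k l (M : 'M[H]_n) a b (X : 'M[H]_(n, k)) (Y : 'M[H]_(n, l)) :
  qhermitian M -> a != b -> M *m X = realq a *: X -> M *m Y = realq b *: Y ->
  X^! *m Y = 0.
Proof.
move=> hM ab MX MY; have : realq (a - b) *: (X^! *m Y) = 0.
  rewrite rmorphB scalerBl scalemxAl -qadj_realqZ -MX qadjM hM -mulmxA MY.
  by rewrite realqZ_mulmx subrr.
move=> /(congr1 (fun Z => realq (a - b)^-1 *: Z)).
by rewrite scalerA -rmorphM mulVf ?subr_eq0 // rmorph1 scale1r scaler0.
Qed.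

Lemma eigenspace_col n k (M : 'M[H]_n) a (E : 'M[H]_(n, k)) :
  (forall j, Defs.eigenspace M a (col j E)) -> M *m E = realq a *: E.
Proof.
move=> ME; apply/matrixP => i j; have /matrixP/(_ i 0) := ME j.
by rewrite rscale_realq !mxE => <-; apply: eq_bigr => l _; rewrite !mxE.
Qed.

Lemma positive_eigenbasis n (M : 'M[H]_n) (s : seq R) (d : seq nat) :
  qhermitian M -> uniq s -> size d = size s -> (forall a, a \in s -> 0 < a) ->
  (forall i, (i < size s)%N -> dim_is (Defs.eigenspace M (nth 0 s i)) (nth 0%N d i)) ->
  exists P : 'M[H]_(n, sumn d), [/\ posfam M P, exists K, M *m P = P *m K,
    forall a, a \in s -> forall x, Defs.eigenspace M a x -> exists c, x = P *m c
    & forall b k (X : 'M[H]_(n, k)), b \notin s -> M *m X = realq b *: X -> P^! *m X = 0].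
Proof.
move=> hM; elim: s d => [|a s IH] [|m d] //=.
  move=> _ _ _ _; exists 0; split=> //; first exact: posfam_void.
    by exists 0; rewrite mulmx0 mul0mx.
  by move=> b k X _ _; rewrite raddf0 mul0mx.
move=> /andP[as_ us] [sd] pos dims.
have [||P [pP [K MP] spanP orthP]] := IH d us sd.
- by move=> b bs; apply: pos; rewrite in_cons bs orbT.
- by move=> i si; apply: (dims i.+1).
have a0 : 0 < a by apply: pos; rewrite mem_head.
have [E [injE eigE spanE]] := dim_is_basis (dims 0%N isT).
have ME := eigenspace_col eigE.
have PE : P^! *m E = 0 by apply: orthP as_ ME.
exists (row_mx E P); split.
- move=> c; rewrite -[c]vsubmxK mul_row_col; set e := usubmx c; set f := dsubmx c => ef0.
  rewrite qfD_orth //; last first.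
    by rewrite qadjM -!mulmxA (mulmxA M) ME -scalemxAl !realqZ_mulmx (mulmxA P^!) PE
      mul0mx mulmx0 scaler0.
  have qE : qf M (E *m e) = a * qf 1%:M (E *m e).
    by rewrite /qf mulmx1 -!mulmxA (mulmxA M) ME -scalemxAl !realqZ_mulmx mxE q0_realqM.
  have [e0|e0] := eqVneq e 0.
    rewrite e0 mulmx0 qf0 add0r; apply: pP; apply: contra_neq ef0 => ->.
    by rewrite e0 col_mx0.
  apply: ltr_pwDl; last exact: posfam_ge0.
  by rewrite qE mulr_gt0 // qf1_gt0 //; apply: contra_neq e0 => /injE.
- exists (block_mx (realq a)%:M 0 0 K).
  rewrite mul_mx_row mul_row_block !mulmx0 addr0 add0r MP ME.
  by rewrite -scalemx1 realqZ_mulmx mulmx1.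
- move=> b; rewrite in_cons => /orP[/eqP ->|bs] x bx.
    by have [c ->] := spanE x bx; exists (col_mx c 0); rewrite mul_row_col mulmx0 addr0.
  have [c ->] := spanP b bs x bx.
  by exists (col_mx 0 c); rewrite mul_row_col mulmx0 add0r.
move=> b k X; rewrite in_cons negb_or => /andP[ba bs] MX.
rewrite qadj_row_mx mul_col_mx (orthP _ _ _ bs MX) (eigen_orth hM _ ME MX) ?col_mx0 //.
by rewrite eq_sym.
Qed.

Lemma pos_inertia_index n (M : 'M[H]_n) p :
  qhermitian M -> pos_inertia M p -> pos_index M p.
Proof.
move=> hM [s [d [us sd eig dims ->]]].
have [|P [pP [K MP] spanP orthP]] := positive_eigenbasis hM us sd _ dims.
  by move=> a /eig[].
split; first by exists P.
case: n M hM eig {dims spanP orthP} P pP K MP spanP => [|n] M hM eig P pP K MP spanP m Q pQ.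
  by rewrite (leq_trans (posfam_leq pQ)).
rewrite leqNgt; apply/negP => /(underdetermined (P^! *m Q))[c c0 PQc].
have := pQ c c0; apply/negP; rewrite -leNgt; apply: (@qf_le0 _ _ _ _ P) => //.
- by move=> x Px; rewrite mulmxA -{1}hM -qadjM MP qadjM -mulmxA Px mulmx0.
- move=> a x a0 Px Mx; apply/eqP; rewrite -[_ == _]negbK; apply/negP => x0.
  have ax : Defs.eigenspace M a x by rewrite /Defs.eigenspace rscale_realq.
  have /spanP/(_ _ ax)[e xe] : a \in s by apply/eig; split=> //; exists x.
  by move: x0; rewrite xe (qadj_mul_eq0 (c := e)) ?eqxx // -mulmxA -xe.
by rewrite mulmxA.
Qed.

Lemma subspace_basis n (V : 'cV[H]_n -> Prop) : subspace V ->
  exists k (A : 'M[H]_(n, k)), [/\ injmx A, forall c, V (A *m c)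
    & forall x, V x -> exists c, x = A *m c].
Proof.
move=> [V0 VD VZ].
pose good k := exists2 A : 'M[H]_(n, k), injmx A & forall c, V (A *m c).
have [||k [A injA VA] max] := @exists_max good n.
- by exists 0 => c; [move=> _; apply/matrixP => -[]|rewrite mul0mx].
- by move=> k [A /injmx_leq].
exists k, A; split=> // x Vx; apply: contrapT => /forallNP xA.
suff /max : good k.+1 by rewrite ltnn.
exists (row_mx x A) => [|c]; first exact: injmx_row_mx.
suff : V (x *m usubmx (c : 'cV_(1 + k)) + A *m dsubmx (c : 'cV_(1 + k))).
  by rewrite -mul_row_col vsubmxK.
by apply: VD => //; rewrite (mx11_scalar (usubmx _)) -rscaleE; apply: VZ.
Qed.

End Inertia.

Theorem theorem5p1 (R : realType) (n : nat) (H1 H2 : 'M[quat R]_n) (p : nat)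
  (hH1 : qhermitian H1) (hH2 : qhermitian H2)
  (iH1 : qinvertible H1) (iH2 : qinvertible H2)
  (pH1 : pos_inertia H1 p) (pH2 : pos_inertia H2 p)
  (V1 V2 : 'cV[quat R]_n -> Prop) (sV1 : subspace V1) (sV2 : subspace V2)
  (U0 : 'cV[quat R]_n -> 'cV[quat R]_n)
  (U0_into : forall x, V1 x -> V2 (U0 x))
  (U0_add : forall x y, V1 x -> V1 y -> U0 (x + y) = U0 x + U0 y)
  (U0_scale : forall x c, V1 x -> U0 (rscale x c) = rscale (U0 x) c)
  (U0_nonsing : forall x, V1 x -> U0 x = 0 -> x = 0)
  (U0_iso : forall x y, V1 x -> V1 y -> ip H2 (U0 x) (U0 y) = ip H1 x y) :
  exists U : 'cV[quat R]_n -> 'cV[quat R]_n,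
    [/\ (forall x y, U (x + y) = U x + U y),
        (forall x c, U (rscale x c) = rscale (U x) c),
        (forall x y, ip H2 (U x) (U y) = ip H1 x y)
      & (forall x, V1 x -> U x = U0 x)].
Proof.
have inj (M : 'M[quat R]_n) : qinvertible M -> injmx M.
  by move=> [B [BM _]] c Mc; rewrite -[c]mul1mx -BM -mulmxA Mc mulmx0.
have [k [A [injA VA spanA]]] := subspace_basis sV1.
have [V0 VD VZ] := sV1.
pose B : 'M[quat R]_(n, k) := \matrix_(i, j) U0 (col j A) i 0.
have VcolA j : V1 (col j A) by rewrite colE.
have U00 : U0 0 = 0 by apply: (addIr (U0 0)); rewrite -U0_add // !add0r.
have U0A c : U0 (A *m c) = B *m c.
  rewrite !mulmx_rscale.
  suff [] : V1 (\sum_j rscale (col j A) (c j 0)) /\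
    U0 (\sum_j rscale (col j A) (c j 0)) = \sum_j rscale (col j B) (c j 0) by [].
  elim/big_ind2: _ => [//|x x' y y' [Vx <-] [Vy <-]|j _].
    by split; [apply: VD|apply: U0_add].
  split; first exact: VZ.
  by rewrite U0_scale //; congr rscale; apply/matrixP => i l; rewrite ord1 !mxE.
have injB : injmx B.
  by move=> c Bc; apply: injA; apply: U0_nonsing => //; rewrite U0A.
have AB : A^! *m H1 *m A = B^! *m H2 *m B.
  have gramE (M : 'M[quat R]_n) (C : 'M_(n, k)) i j :
      (C^! *m M *m C) i j = ip M (C *m delta_mx j 0) (C *m delta_mx i 0) 0 0.
    have qd : (delta_mx i 0)^! = delta_mx 0 i :> 'M[quat R]_(1, k).
      apply/matrixP => r l; rewrite qadjE !mxE andbC.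
      by case: (_ && _); apply: quatP; split; rewrite /= ?oppr0.
    transitivity ((delta_mx 0 i *m (C^! *m M *m C) *m delta_mx j 0 : 'M_1) 0 0).
      by rewrite -rowE -colE !mxE.
    by rewrite /ip qadjM qd !mulmxA.
  by apply/matrixP => i j; rewrite !gramE -!U0A U0_iso.
have [U UA UH] := witt_mx hH1 hH2 (inj _ iH1) (inj _ iH2) (pos_inertia_index hH1 pH1)
  (pos_inertia_index hH2 pH2) injA injB AB.
exists (fun x => U *m x); split.
- by move=> x y; rewrite mulmxDr.
- by move=> x c; rewrite !rscaleE mulmxA.
- by move=> x y; rewrite /ip qadjM -UH !mulmxA.
by move=> x /spanA[c ->]; rewrite mulmxA UA U0A.
Qed.
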